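(* In Ultimate Tic-Tac-Toe, an optimal winning strategy for Xavier (the first player) takes at most 43 moves, counting the moves of both players. That is, the length of an optimal winning strategy for Xavier is at most $43$.
   Context: **Game.** Ultimate Tic-Tac-Toe is played on a board of 9 fields arranged in a $3\times3$ grid, indexed row by row from the top left: $0,1,2$ / $3,4,5$ / $6,7,8$. Each field consists of 9 spots arranged in a $3\times 3$ grid and indexed in the same way; $(i,j)$ denotes spot $j$ of field $i$. The lines of a $3\times3$ grid are its three rows, three columns and two diagonals. Xavier (marks X) moves first, then Olivia (marks O) and Xavier alternate; a move places one mark in a free spot of the active field. If the previous move was $(i,j)$ and field $j$ has a free spot, the active field is $j$ (whether or not field $j$ has already been won). If the previous move was $(i,j)$ and field $j$ has no free spot, or if there is no previous move, the player to move freely chooses as active field any field with a free spot. A player wins a field when they are the first to have three of their marks on a line of that field; once won, the status of a field never changes, though its free spots can still be played. A player wins the game when they have won three fields forming a line of the board, and the game then ends. If the board is filled with no winner the game is a draw. **Optimality.** A strategy for Xavier is winning if Xavier wins the game in every play consistent with it. The length of a winning strategy is the maximum, over all plays by Olivia, of the total number of moves (by both players) made up to and including Xavier's winning move. A winning strategy for Xavier is optimal if its length is minimal among all winning strategies for Xavier. *)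

(* Defs.v *)
From HB Require Import structures.
From mathcomp Require Import all_boot all_algebra.

Set Implicit Arguments.
Unset Strict Implicit.
Unset Printing Implicit Defensive.

Inductive player := Xavier | Olivia.

Definition is_xavier (p : player) : bool := if p is Xavier then true else false.

Lemma is_xavierK :
  cancel is_xavier (fun b : bool => if b then Xavier else Olivia).
Proof. by case. Qed.

HB.instance Definition _ := Equality.copy player (can_type is_xavierK).

Definition opponent (p : player) : player :=
  if p is Xavier then Olivia else Xavier.

(* The move (i, j) puts a mark on spot j of field i. *)
Definition move : Type := 'I_9 * 'I_9.

(* Numerals denote elements of 'I_9 through its ring structure; all of them
   are smaller than 9, so there is no reduction modulo 9. *)
Definition lines : seq (seq 'I_9) :=
  [:: [:: 0; 1; 2]; [:: 3; 4; 5]; [:: 6; 7; 8];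
      [:: 0; 3; 6]; [:: 1; 4; 7]; [:: 2; 5; 8];
      [:: 0; 4; 8]; [:: 2; 4; 6]]%R.

Definition has_line (A : pred 'I_9) : bool := has (all A) lines.

Record position := Position {
  mark : move -> option player;
  status : 'I_9 -> option player;
  previous : option move;
  turn : player
}.

Definition start : position :=
  Position (fun=> None) (fun=> None) None Xavier.

Definition free_spot (p : position) (m : move) : bool := mark p m == None.

Definition has_free (p : position) (i : 'I_9) : bool :=
  [exists j : 'I_9, free_spot p (i, j)].

(* The possible choices of the active field: a single one, unless there is no
   previous move or the previous move points to a field without free spot. *)
Definition can_activate (p : position) (i : 'I_9) : bool :=
  if previous p is Some (_, j) then
    if has_free p j then i == j else has_free p i
  else has_free p i.

Definition wins (p : position) (w : player) : bool :=
  has_line (fun i => status p i == Some w).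

Definition full (p : position) : bool := [forall i, ~~ has_free p i].

Definition ended (p : position) : bool :=
  [|| wins p Xavier, wins p Olivia | full p].

Definition legal (p : position) (m : move) : bool :=
  [&& ~~ ended p, can_activate p m.1 & free_spot p m].

Definition make_move (p : position) (m : move) : position :=
  let w := turn p in
  let mark' x := if x == m then Some w else mark p x in
  let captured := (status p m.1 == None)
                    && has_line (fun j => mark' (m.1, j) == Some w) in
  let status' i := if (i == m.1) && captured then Some w else status p i in
  Position mark' status' (Some m) (opponent w).

Definition after (g : seq move) : position := foldl make_move start g.

Fixpoint legal_from (p : position) (g : seq move) : bool :=
  if g is m :: g' then legal p m && legal_from (make_move p m) g' else true.

Definition legal_play (g : seq move) : bool := legal_from start g.

Definition complete_play (g : seq move) : bool :=
  legal_play g && ended (after g).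

(* A strategy for Xavier may depend on the whole sequence of moves made so
   far; what it returns when Xavier is not to move is irrelevant. *)
Record strategy := Strategy {
  choose_move :> seq move -> move;
  choose_move_legal : forall g : seq move,
    legal_play g -> ~~ ended (after g) -> turn (after g) = Xavier ->
    legal (after g) (choose_move g)
}.

Definition consistent (s : strategy) (g : seq move) : bool :=
  [forall k : 'I_(size g),
    (turn (after (take k g)) == Xavier) ==>
      (onth g k == Some (s (take k g)))].

Definition winning (s : strategy) : Prop :=
  forall g : seq move,
    complete_play g -> consistent s g -> wins (after g) Xavier.

(* There are 81 spots, hence no play has more than 81 moves (see
   size_legal_play): the maximum ranges over all complete plays consistent
   with s. *)
Definition strategy_length (s : strategy) : nat :=
  \max_(g : {bseq 81 of move} | complete_play g && consistent s g) size g.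

Definition optimal (s : strategy) : Prop :=
  winning s /\
  forall t : strategy, winning t -> strategy_length s <= strategy_length t.

Lemma legal_from_uniq (p : position) (g : seq move) :
  legal_from p g -> uniq g && all (free_spot p) g.
Proof.
elim: g p => //= m g IHg p /andP[/and3P[_ _ free_m] /IHg/andP[-> /allP free_g]].
rewrite free_m andbT andTb; apply/andP; split.
  by apply/negP => /free_g; rewrite /free_spot /= eqxx.
apply/allP => x /free_g; rewrite /free_spot /=.
by case: (x == m).
Qed.

Lemma size_legal_play (g : seq move) : legal_play g -> size g <= 81.
Proof.
move=> /legal_from_uniq/andP[/card_uniqP <- _].
by apply: leq_trans (max_card _) _; rewrite card_prod card_ord.
Qed.

Lemma leq_strategy_length (s : strategy) (g : seq move) :
  complete_play g -> consistent s g -> size g <= strategy_length s.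
Proof.
move=> g_complete g_s.
have g81 : size g <= 81 by case/andP: g_complete => /size_legal_play.
by apply: (@leq_bigmax_cond _ _ _ (Bseq g81)); rewrite /= g_complete.
Qed.

(* Main.v *)
(* Xavier opens with (4, 4) and answers every move (4, k) by (k, 4), so that
   Olivia keeps playing in field 4 while Xavier collects the centers of the
   other fields. When Olivia fills field 4 with her eighth move (4, c), Xavier
   deviates and plays (c, c). From then on he plays spot c of the active field
   if it is free, and spot 8 - c otherwise, which completes the line c, 4, 8 - c
   of that field; if Olivia leaves him a free choice by playing (c, 4), he
   chooses field 8 - c. This confines Olivia to the fields c and 8 - c.
   That Xavier wins by move 43 is checked by computing, round after round, all
   positions that Olivia can reach; those reached by several orders of moves
   are merged, which leaves fewer than 9000 of them in each round. *)
Require Import Defs.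
From mathcomp Require Import all_boot all_algebra.
From Stdlib Require Import Classical_Prop.

Set Implicit Arguments.
Unset Strict Implicit.
Unset Printing Implicit Defensive.

(** * Wins that Xavier can force in a bounded number of moves of both players *)

Fixpoint forced_win (n : nat) (p : position) : bool :=
  wins p Xavier ||
  if n isn't n'.+1 then false else
  ~~ ended p &&
  if turn p == Xavier
  then [exists m, legal p m && forced_win n' (make_move p m)]
  else [forall m, legal p m ==> forced_win n' (make_move p m)].

Lemma forced_win_move (n : nat) (p : position) (m : move) :
  turn p = Xavier -> legal p m -> forced_win n (make_move p m) ->
  forced_win n.+1 p.
Proof.
move=> pX m_legal m_wins; have /and3P[going _ _] := m_legal.
rewrite /= going pX /=; apply/orP; right.
by apply/existsP; exists m; rewrite m_legal.
Qed.

Lemma forced_win_replies (n : nat) (p : position) :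
  turn p = Olivia -> ~~ ended p ->
  (forall m, legal p m -> forced_win n (make_move p m)) ->
  forced_win n.+1 p.
Proof.
move=> pO going wins_all; rewrite /= going pO /=; apply/orP; right.
by apply/forallP => m; apply/implyP; exact: wins_all.
Qed.

(** An unfinished game leaves a free spot; it may be played unless the previous move points to a
    field with free spots, and then one of those is legal. *)
Lemma exists_legal (p : position) : ~~ ended p -> [exists m, legal p m].
Proof.
move=> p_going; have /existsP[i /existsP[j free_ij]] : [exists i, has_free p i].
  move: p_going; rewrite /ended /full !negb_or => /and3P[_ _].
  by case/forallPn => i; rewrite negbK => i_free; apply/existsP; exists i.
have free_i : has_free p i by apply/existsP; exists j.
apply/existsP; case prev_p: (previous p) => [[k l]|]; last first.
  by exists (i, j); rewrite /legal p_going /can_activate prev_p free_i.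
case free_l: (has_free p l); last first.
  by exists (i, j); rewrite /legal p_going /can_activate prev_p free_l free_i.
have /existsP[j' free_lj'] := free_l.
by exists (l, j'); rewrite /legal p_going /can_activate prev_p free_l eqxx.
Qed.

(** * From a bounded forced win to a winning strategy *)

Lemma after_rcons (g : seq move) (m : move) :
  after (rcons g m) = make_move (after g) m.
Proof. by rewrite /after foldl_rcons. Qed.

Lemma legal_from_onth (p : position) (g : seq move) (k : nat) (m : move) :
  legal_from p g -> onth g k = Some m -> legal (foldl make_move p (take k g)) m.
Proof.
elim: g p k => [|m' g IHg] p [|k] //= /andP[m'_legal g_legal] => [[<-]//|].
exact: IHg.
Qed.

(* The default (ord0, ord0) is reached only when there is no legal move. *)
Definition guided_move (N : nat) (g : seq move) : move :=
  let p := after g in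
  if [pick m | legal p m && forced_win (N - size g).-1 (make_move p m)]
    is Some m then m
  else if [pick m | legal p m] is Some m then m else (ord0, ord0).

Lemma guided_move_legal (N : nat) (g : seq move) :
  legal_play g -> ~~ ended (after g) -> turn (after g) = Xavier ->
  legal (after g) (guided_move N g).
Proof.
move=> _ g_going _; rewrite /guided_move.
case: pickP => [m /andP[]//|_]; case: pickP => [m //|none].
by have /existsP[m] := exists_legal g_going; rewrite none.
Qed.

Definition guided (N : nat) : strategy := Strategy (@guided_move_legal N).

(** Invariant of the play: on his turns Xavier picks a move that keeps the win forced with one move
    less, and on hers every move of Olivia does so. *)
Lemma guided_forced (N : nat) (g : seq move) (k : nat) :
  forced_win N start -> complete_play g -> consistent (guided N) g ->
  k <= size g -> forced_win (N - k) (after (take k g)).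
Proof.
move=> N_wins /andP[g_legal _] /forallP g_guided.
elim: k => [|k IHk] k_g; first by rewrite subn0 take0.
have [m g_k] : exists m, onth g k = Some m.
  by move: k_g; rewrite -onthTE; case: (onth g k) => // m _; exists m.
have m_legal := legal_from_onth g_legal g_k.
have going : ~~ ended (after (take k g)) by case/and3P: m_legal.
move: {IHk}(IHk (ltnW k_g)).
have -> : take k.+1 g = rcons (take k g) m.
  by rewrite (take_nth m k_g); congr rcons; apply: onth_nth g_k.
rewrite after_rcons.
have no_win : wins (after (take k g)) Xavier = false.
  by apply/negbTE; move: going; rewrite /ended negb_or => /andP[].
(* [N - k = 0] would mean that Xavier has already won, although [m] is still legal. *)
case def_n: (N - k) => [|n] /=; rewrite no_win //= going.
have -> : N - k.+1 = n by rewrite subnS def_n.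
case: ifP => [k_X|_]; last by move/forallP/(_ m)/implyP; apply.
have := g_guided (Ordinal k_g); rewrite /= k_X g_k /= => /eqP[->].
(* The first [pick] cannot fail: the invariant provides a suitable move. *)
rewrite /guided_move; case: pickP => [m' /andP[_]|none /existsP[m']].
  by rewrite size_takel ?(ltnW k_g) // def_n.
by have := none m'; rewrite size_takel ?(ltnW k_g) // def_n => ->.
Qed.

(** At the end of the play the invariant can only hold through a win of Xavier; after [N] moves it
    says that he has won, so no further move is legal. *)
Lemma guided_wins (N : nat) (g : seq move) :
  forced_win N start -> complete_play g -> consistent (guided N) g ->
  wins (after g) Xavier && (size g <= N).
Proof.
move=> N_wins g_complete g_guided.
have forced k := guided_forced N_wins g_complete g_guided (k := k).
have /andP[g_legal g_ended] := g_complete.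
apply/andP; split.
  have := forced (size g) (leqnn _); rewrite take_size.
  by case: (N - size g) => [|n] /= /orP[]//; rewrite g_ended.
rewrite leqNgt; apply/negP => N_g; have := forced N (ltnW N_g).
have [m g_N] : exists m, onth g N = Some m.
  by move: N_g; rewrite -onthTE; case: (onth g N) => // m _; exists m.
have /and3P[going _ _] := legal_from_onth g_legal g_N.
by rewrite subnn /= orbF => won; rewrite /ended won in going.
Qed.

Lemma guided_winning (N : nat) :
  forced_win N start -> winning (guided N) /\ strategy_length (guided N) <= N.
Proof.
move=> N_wins; split=> [g g_c g_s|].
  by case/andP: (guided_wins N_wins g_c g_s).
apply/bigmax_leqP => g /andP[g_c g_s].
by case/andP: (guided_wins N_wins g_c g_s).
Qed.

(** Descent on the length: a winning strategy that is not optimal is beaten by a shorter one. *)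
Lemma exists_optimal (s : strategy) : winning s -> exists t, optimal t.
Proof.
have [n] := ubnP (strategy_length s); elim: n s => // n IHn s s_n s_win.
have [s_opt|] := classic (optimal s); first by exists s.
move=> not_opt; apply: NNPP => no_opt; apply: not_opt; split=> // t t_win.
rewrite leqNgt; apply/negP => t_s; apply: no_opt; apply: (IHn t) => //.
exact: leq_trans t_s s_n.
Qed.

(** * A model of the game suited to computation, and Xavier's moves in it *)

Notation cell := (option player).

(* Fields as rows of spots, owners of the fields, and the field to which the
   previous move points. The player to move is known from the context. *)
Notation state := (seq (seq cell) * seq cell * option nat)%type.

Definition board (s : state) : seq (seq cell) := s.1.1.
Definition owners (s : state) : seq cell := s.1.2.
Definition target (s : state) : option nat := s.2.

Definition nat_lines : seq (seq nat) :=
  [:: [:: 0; 1; 2]; [:: 3; 4; 5]; [:: 6; 7; 8];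
      [:: 0; 3; 6]; [:: 1; 4; 7]; [:: 2; 5; 8];
      [:: 0; 4; 8]; [:: 2; 4; 6]].

Definition same_player (u v : player) : bool :=
  match u, v with Xavier, Xavier | Olivia, Olivia => true | _, _ => false end.

Definition same_cell (u v : cell) : bool :=
  match u, v with
  | Some x, Some y => same_player x y | None, None => true | _, _ => false
  end.

Fixpoint same_row (r s : seq cell) : bool :=
  match r, s with
  | [::], [::] => true
  | None :: r', None :: s'
  | Some Xavier :: r', Some Xavier :: s'
  | Some Olivia :: r', Some Olivia :: s' => same_row r' s'
  | _, _ => false
  end.

Fixpoint same_board (b c : seq (seq cell)) : bool :=
  match b, c with
  | [::], [::] => true
  | r :: b', s :: c' => if same_row r s then same_board b' c' else false
  | _, _ => false
  end.

Definition same_target (u v : option nat) : bool :=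
  match u, v with
  | Some i, Some j => eqn i j | None, None => true | _, _ => false
  end.

(* Unlike [&&], conditionals do not evaluate both sides in [vm_compute]. *)
Definition same_state (s t : state) : bool :=
  if same_target (target s) (target t) then
    if same_row (owners s) (owners t) then same_board (board s) (board t)
    else false
  else false.

Definition lined (w : player) (r : seq cell) : bool :=
  has (all (fun i => same_cell (nth None r i) (Some w))) nat_lines.

Definition cell_at (s : state) (i j : nat) : cell :=
  nth None (nth [::] (board s) i) j.

Definition is_full (s : state) (i : nat) : bool :=
  let r := nth [::] (board s) i in all (fun j => nth None r j) (iota 0 9).

Definition is_over (s : state) : bool :=
  [|| lined Xavier (owners s), lined Olivia (owners s)
    | all (is_full s) (iota 0 9)].

Definition play (w : player) (m : nat * nat) (s : state) : state :=
  let: (i, j) := m in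
  let r := set_nth None (nth [::] (board s) i) j (Some w) in
  (set_nth [::] (board s) i r,
   if nth None (owners s) i is None then
     if lined w r then set_nth None (owners s) i (Some w) else owners s
   else owners s,
   Some j).

(** [None] stands for a free choice, at the start as well as when the target is full. *)
Definition active (s : state) : option nat :=
  if target s is Some j then if is_full s j then None else Some j else None.

Definition moves (s : state) : seq (nat * nat) :=
  flatten [seq [seq (i, j) | j <- iota 0 9 & ~~ isSome (cell_at s i j)]
          | i <- if active s is Some f then [:: f] else iota 0 9].

Definition is_legal (s : state) (m : nat * nat) : bool :=
  [&& ~~ is_over s, m.1 < 9, m.2 < 9,
      (if active s is Some f then eqn m.1 f else true)
    & ~~ isSome (cell_at s m.1 m.2)].

(* The spot that sends Olivia back where Xavier wants her: the center until
   field 4 is full, then the only field whose center Xavier does not hold. *)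
Definition sink (s : state) : nat :=
  if is_full s 4
  then find (fun i => ~~ same_cell (cell_at s i 4) (Some Xavier)) (iota 0 9)
  else 4.

(** Spot [8 - c] is opposite to [c] through the center. At the start [c] is 4, hence so is [8 - c],
    which gives the opening (4, 4). *)
Definition xavier_move (s : state) : nat * nat :=
  let c := sink s in
  let f := if active s is Some f then f else 8 - c in
  (f, if cell_at s f c is None then c else 8 - c).

(** * Sets of states without repetition, stored in tries *)

(** The subtrees of a node correspond to the next cell of the key: free, Xavier's, Olivia's. *)
Inductive trie := Leaf | Node of seq state & trie & trie & trie.

Fixpoint insert (k : seq cell) (s : state) (t : trie) : trie :=
  let: (l, t0, tx, to) :=
    if t is Node l t0 tx to then (l, t0, tx, to)
    else ([::], Leaf, Leaf, Leaf) in
  match k with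
  | [::] => Node (if has (same_state s) l then l else s :: l) t0 tx to
  | None :: k' => Node l (insert k' s t0) tx to
  | Some Xavier :: k' => Node l t0 (insert k' s tx) to
  | Some Olivia :: k' => Node l t0 tx (insert k' s to)
  end.

Fixpoint elements (t : trie) : seq state :=
  if t is Node l t0 tx to then l ++ elements t0 ++ elements tx ++ elements to
  else [::].

Definition replies (s : state) : seq state :=
  [seq play Olivia m s | m <- moves s].

(* Equal keys need not mean equal states: each node of a trie keeps a list of
   states, and a key only has to make these lists short. *)
Definition key (s : state) : seq cell :=
  let c := sink s in
  [seq nth None r 4 | r <- board s] ++
  nth [::] (board s) c ++ nth [::] (board s) (8 - c).

Definition collect (l : seq state) : seq state :=
  elements (foldl (fun t s => insert (key s) s t) Leaf l).

(** Breadth-first search: [l] holds states with Xavier to move, and [k] bounds the number of his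
    moves. States he has just won are dropped, and none may be left when [k] is 0. *)
Fixpoint forces (k : nat) (l : seq state) : bool :=
  if k is k'.+1 then
    all (fun s => is_legal s (xavier_move s)) l &&
    (let l1 := [seq play Xavier (xavier_move s) s | s <- l] in
     let l2 := [seq s <- l1 | ~~ lined Xavier (owners s)] in
     all (fun s => ~~ is_over s) l2 &&
     forces k' (collect (flatten [seq replies s | s <- l2])))
  else nilp l.

Definition init : state := (nseq 9 (nseq 9 None), nseq 9 None, None).

(** * Correctness of the model and of the search *)

Record represents (s : state) (p : position) : Prop := Represents {
  mark_represents : forall i j : 'I_9, mark p (i, j) = cell_at s i j;
  status_represents : forall i : 'I_9, status p i = nth None (owners s) i;
  target_represents : target s = omap (fun m : move => val m.2) (previous p)
}.

Lemma represents_init : represents init start.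
Proof.
split=> // [i j|i]; last by rewrite nth_nseq if_same.
by rewrite /cell_at !nth_nseq ltn_ord nth_nseq if_same.
Qed.

Lemma same_cellE (u v : cell) : same_cell u v = (u == v).
Proof. by case: u => [[]|]; case: v => [[]|]. Qed.

Lemma same_rowP (r s : seq cell) : same_row r s -> r = s.
Proof. by elim: r s => [|[[]|] r IHr] [|[[]|] s] //= /IHr ->. Qed.

Lemma same_boardP (b c : seq (seq cell)) : same_board b c -> b = c.
Proof.
elim: b c => [|r b IHb] [|s c] //=; case: ifP => // /same_rowP -> /IHb -> //.
Qed.

Lemma same_targetP (u v : option nat) : same_target u v -> u = v.
Proof. by case: u v => [i|] [j|] //= /eqnP ->. Qed.

Lemma same_stateP (s t : state) : same_state s t -> s = t.
Proof.
case: s t => [[b o] u] [[c q] v]; rewrite /same_state /target /owners /board /=.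
do 2![case: ifP => //].
by move=> /same_rowP -> /same_targetP -> /same_boardP ->.
Qed.

(** A state is left out only if [same_state] finds it in the list, and then it is equal to a
    member. *)
Lemma mem_insert (k : seq cell) (s x : state) (t : trie) :
  x \in s :: elements t -> x \in elements (insert k s t).
Proof.
elim: k t => [|u k IHk] t.
  case: t => [//|l t0 tx to] /=; rewrite inE !mem_cat.
  case: ifP => [/hasP[y y_l /same_stateP ->]|_].
    by case/predU1P => [->|//]; rewrite y_l.
  by rewrite inE orbA.
have in_insert t' :
    (x == s) || (x \in elements t') -> x \in elements (insert k s t').
  exact: IHk.
rewrite inE; case: t => [|l t0 tx to] x_in.
  by case: u => [[]|] /=; rewrite ?cats0 in_insert.
case: u => [[]|] /=; move: x_in => /=; rewrite !mem_cat;
  by case/orP => [x_t|/or4P[] x_t];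
    rewrite ?x_t ?orbT // in_insert ?x_t ?orbT.
Qed.

Lemma sub_collect (l : seq state) : {subset l <= collect l}.
Proof.
move=> x x_l; rewrite /collect; set t := Leaf.
(* The initial trie is generalized, since [foldl] changes it. *)
have : (x \in l) || (x \in elements t) by rewrite x_l.
move: t {x_l}; elim: l => //= s l IHl t; rewrite inE -orbA => x_in.
apply: IHl; case/or3P: x_in => [x_s|->//|x_t].
  by rewrite mem_insert ?orbT // inE x_s.
by rewrite mem_insert ?orbT // inE x_t orbT.
Qed.

Lemma linedE (w : player) (r : seq cell) (A : pred 'I_9) :
  (forall i : 'I_9, A i = (nth None r i == Some w)) -> lined w r = has_line A.
Proof.
move=> rA; rewrite /lined.
have -> : nat_lines = [seq [seq val i | i <- l] | l <- lines] by [].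
rewrite has_map; apply: eq_has => l /=; rewrite all_map.
by apply: eq_all => i /=; rewrite same_cellE rA.
Qed.

Lemma all_ord9 (P : pred nat) : all P (iota 0 9) = [forall i : 'I_9, P i].
Proof.
rewrite -val_enum_ord all_map.
apply/allP/forallP => [PI i|PI i _]; last exact: PI.
by apply: PI; rewrite mem_enum.
Qed.

Section Represented.

Variables (s : state) (p : position).
Hypothesis s_p : represents s p.

Lemma free_spotE (i j : 'I_9) : free_spot p (i, j) = ~~ isSome (cell_at s i j).
Proof. by rewrite /free_spot (mark_represents s_p); case: cell_at. Qed.

Lemma is_fullE (i : 'I_9) : is_full s i = ~~ has_free p i.
Proof.
rewrite /is_full all_ord9 negb_exists; apply: eq_forallb => j.
by rewrite free_spotE negbK.
Qed.

Lemma lined_owners (w : player) : lined w (owners s) = wins p w.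
Proof. by apply: linedE => i; rewrite (status_represents s_p). Qed.

Lemma is_overE : is_over s = ended p.
Proof.
rewrite /is_over !lined_owners all_ord9; do 2!congr (_ || _).
by apply: eq_forallb => i; rewrite is_fullE.
Qed.

Lemma can_activateE (i : 'I_9) :
  can_activate p i = if active s is Some f then i == f :> nat else has_free p i.
Proof.
rewrite /can_activate /active (target_represents s_p).
case: (previous p) => [[k l]|] //=; rewrite is_fullE.
by case: (has_free p l).
Qed.

Lemma is_legalP (m : nat * nat) :
  is_legal s m -> exists2 q : move, m = (val q.1, val q.2) & legal p q.
Proof.
case: m => i j /and5P[/= going i9 j9 act free].
exists (Ordinal i9, Ordinal j9) => //; rewrite /legal -is_overE going /=.
rewrite can_activateE free_spotE free andbT.
case: (active s) act => [f /eqnP/eqP//|_].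
(* The spot played shows that the field chosen has a free spot. *)
by apply/existsP; exists (Ordinal j9); rewrite free_spotE.
Qed.

Lemma legal_moves (m : move) : legal p m -> (val m.1, val m.2) \in moves s.
Proof.
case: m => i j /and3P[_ /= act free].
apply/flattenP.
exists [seq (val i, k) | k <- iota 0 9 & ~~ isSome (cell_at s i k)].
  apply/mapP; exists (val i) => //.
  move: act; rewrite can_activateE.
  case: (active s) => [f /eqP <-|_]; first exact: mem_head.
  by rewrite mem_iota /= ltn_ord.
apply/mapP; exists (val j) => //.
by rewrite mem_filter -free_spotE free mem_iota /= ltn_ord.
Qed.

Lemma represents_play (w : player) (m : move) :
  turn p = w -> represents (play w (val m.1, val m.2) s) (make_move p m).
Proof.
case: m => i j p_w; split=> [k l|k|//].
  rewrite /cell_at /= nth_set_nth /= p_w xpair_eqE val_eqE.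
  case: (k =P i) => [->|_] /=; last exact: mark_represents.
  by rewrite nth_set_nth /= val_eqE; case: eqP => // _; exact: mark_represents.
(* The test for capturing field [i] gives the same answer in both models. *)
have lined_i : lined w (set_nth None (nth [::] (board s) i) j (Some w)) =
    has_line (fun l =>
      (if (i, l) == (i, j) then Some w else mark p (i, l)) == Some w).
  apply: linedE => l; rewrite nth_set_nth /= xpair_eqE eqxx val_eqE /=.
  by case: (l =P j) => // _; rewrite (mark_represents s_p).
rewrite /= p_w -lined_i (status_represents s_p i) /owners /=.
rewrite (status_represents s_p).
case own_i: (nth None _ _) => [v|] /=; first by rewrite andbF.
case: (lined _ _); rewrite ?andbF // andbT nth_set_nth /= val_eqE.
by case: eqP.
Qed.

End Represented.

(** [k] moves of Xavier enclose [k - 1] replies, whence the bound [2k - 1]. Unless his move wins,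
    each legal reply leads to a state in the list of the next round. *)
Lemma forces_forced_win (k : nat) (l : seq state) (s : state) (p : position) :
  forces k l -> s \in l -> represents s p -> turn p = Xavier ->
  forced_win k.*2.-1 p.
Proof.
elim: k l s p => [[]//|k IHk] l s p /= /and3P[legal_l going l_forces] s_l s_p pX.
have [m sm m_legal] := is_legalP s_p (allP legal_l s s_l).
apply: (forced_win_move pX m_legal).
set p' := make_move p m.
set s' := play Xavier (xavier_move s) s.
have s'_p' : represents s' p' by rewrite /s' sm; apply: represents_play.
have p'O : turn p' = Olivia by rewrite /p' /= pX.
case won: (wins p' Xavier); first by case: (k.*2) => [|n] /=; rewrite won.
move: going l_forces; set l2 := filter _ _ => going l_forces.
have s'_l2 : s' \in l2.
  rewrite mem_filter (lined_owners s'_p') won.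
  exact: (map_f (fun t => play Xavier (xavier_move t) t)).
have p'_going : ~~ ended p' by rewrite -(is_overE s'_p') (allP going).
have reply q : legal p' q ->
    exists2 t, t \in collect (flatten [seq replies s | s <- l2])
             & represents t (make_move p' q).
  move=> q_legal; exists (play Olivia (val q.1, val q.2) s').
    apply: sub_collect; apply/flattenP; exists (replies s'); first exact: map_f.
    by apply: map_f; apply: legal_moves q_legal.
  exact: represents_play.
(* In the last round the list of replies is empty, but a game that is not over has a legal reply. *)
case: k IHk l_forces => [_ /nilP no_reply|k IHk l_forces].
  have /existsP[q /reply[t]] := exists_legal p'_going.
  by rewrite no_reply.
apply: forced_win_replies => // q /reply[t t_l2 t_q].
by apply: (IHk _ _ _ l_forces t_l2 t_q); rewrite /= pX.
Qed.

(** * The computation and the bound *)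

(** Among 43 alternating moves 22 are Xavier's. The search is run by the kernel at [Qed]. *)
Lemma forces_init : forces 22 [:: init].
Proof. by vm_cast_no_check (erefl true). Qed.

Lemma start_forced_win : forced_win 43 start.
Proof.
exact: (forces_forced_win forces_init (mem_head _ _) represents_init erefl).
Qed.

(** The existence of an optimal strategy keeps the bound from being vacuous; the bound follows by
    comparison with [guided 43]. *)
Theorem lemma3 :
  (exists s : strategy, optimal s) /\
  (forall s : strategy, optimal s -> strategy_length s <= 43).
Proof.
have [s_win s_43] := guided_winning start_forced_win; split.
  exact: exists_optimal s_win.
by move=> s [_ s_min]; apply: leq_trans (s_min _ s_win) s_43.
Qed.
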